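(* Let $p=p(n)$ satisfy $\frac1n\ll p\le1$. Consider majority bootstrap percolation on $G_{n,p}$ in which the vertices are initially activated independently with probability $q\in(0,1)$; let $A(0)$ be the (random) number of initially active vertices and $A^*$ the size of the final active set. (i) If $q<\frac12$, then $A^*=A(0)(1+o_{\mathrm p}(1))$. (ii) If $q>\frac12$, then $A^*=n-o_{\mathrm p}(n)$.
   Context: $G_{n,p}$ is the random graph on $V_n=\{1,\dots,n\}$ in which each possible edge is present independently with probability $p=p(n)$. Here $q$ is a constant, and the set $\mathcal A(0)$ of initially active vertices is obtained by activating each vertex with probability $q$, independently of the other vertices and of the graph, so $A(0)=|\mathcal A(0)|$ has the binomial distribution $\mathrm{Bin}(n,q)$. Majority bootstrap percolation: an inactive vertex $v$ becomes active as soon as its number of active neighbours is at least $\max\left(\tfrac12\deg(v),1\right)$, i.e. it has at least one active neighbour and at least half of its neighbours are active. Active vertices stay active. This is repeated until no more vertices become active; $\mathcal A^*$ is the final active set and $A^*=|\mathcal A^*|$. All limits are as $n\to\infty$; $p\gg\frac1n$ means $np\to\infty$; $X_n=o_{\mathrm p}(a_n)$ means $X_n/a_n\to0$ in probability. *)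

(* Defs.v *)
From HB Require Import structures.
From mathcomp Require Import all_boot all_order all_algebra.
From mathcomp Require Import all_classical all_reals all_analysis.
Import Order.TTheory GRing.Theory Num.Theory.
Import numFieldNormedType.Exports.

Set Implicit Arguments.
Unset Strict Implicit.
Unset Printing Implicit Defensive.

Local Open Scope classical_set_scope.
Local Open Scope ring_scope.

(* A potential edge of a simple graph on the vertex set 'I_n. *)
Definition edge (n : nat) := {e : {set 'I_n} | #|e| == 2%N}.

Section Percolation.
Variables (n : nat) (E : {set edge n}).
Implicit Types (A : {set 'I_n}) (u v : 'I_n).

Definition adj u v : bool := [exists e in E, val e == [set u; v]%SET].

Definition neighbours v : {set 'I_n} := [set u | adj v u]%SET.

Definition deg v : nat := #|neighbours v|.

Definition active_deg A v : nat := #|neighbours v :&: A|.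

Definition activable A v : bool :=
  Num.max ((deg v)%:R / 2) 1 <= (active_deg A v)%:R :> rat.

Definition step A : {set 'I_n} := (A :|: [set v | activable A v])%SET.

(* n rounds always suffice to reach stability: see iter_step_max. *)
Definition final_active A : {set 'I_n} := iter n step A.

Lemma iter_step_max A t : (n <= t)%N -> iter t step A = final_active A.
Proof.
have stab s r : iter s.+1 step A = iter s step A -> (s <= r)%N ->
    iter r step A = iter s step A.
  by move=> h /subnKC <-; elim: (r - s)%N => [|k IH]; rewrite ?addn0 // addnS iterS IH -iterS.
have grow s : (forall r, (r < s)%N -> iter r.+1 step A != iter r step A) ->
    (s <= #|iter s step A|)%N.
  elim: s => // s IH h; apply: leq_ltn_trans (IH _) _ => [r rs|].
    by apply: h; exact: ltnW.
  rewrite proper_card// finset.properEneq eq_sym h//= /step.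
  exact: finset.subsetUl.
move=> nt; have [/existsP[s /eqP hs]|] :=
    boolP [exists s : 'I_n.+1, iter s.+1 step A == iter s step A].
  have sn : (s <= n)%N by rewrite -ltnS.
  rewrite /final_active (stab s t) ?(stab s n)//; exact: leq_trans nt.
rewrite negb_exists => /forallP h.
have := grow n.+1 (fun r hr => h (Ordinal hr)).
by move=> /leq_trans/(_ (max_card _)); rewrite card_ord ltnn.
Qed.

Lemma step_final_active A : step (final_active A) = final_active A.
Proof. exact: (@iter_step_max A n.+1). Qed.

End Percolation.

(* The pair (set of initially active vertices, edge set of the graph). *)
Definition outcome (n : nat) : finType := ({set 'I_n} * {set edge n})%type.

Definition A0 (n : nat) (w : outcome n) : nat := #|w.1|.

Definition Astar (n : nat) (w : outcome n) : nat := #|final_active w.2 w.1|.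

Section Probability.
Variable R : realType.

(* Joint law of independent Bernoulli(q) activations and the edges of
   G_(n,p). *)
Definition weight (q : R) (p : nat -> R) (n : nat) (w : outcome n) : R :=
  (\prod_(v : 'I_n) (if v \in w.1 then q else 1 - q)) *
  (\prod_(e : edge n) (if e \in w.2 then p n else 1 - p n)).

Lemma weight_ge0 q p n (w : outcome n) :
  0 <= q <= 1 -> 0 <= p n <= 1 -> 0 <= weight q p w.
Proof.
move=> /andP[q0 q1] /andP[p0 p1]; apply: mulr_ge0; apply: prodr_ge0 => i _;
  by case: ifP => // _; rewrite subr_ge0.
Qed.

Lemma sum_weight q p n : \sum_(w : outcome n) weight q p w = 1.
Proof.
have tot (I : finType) (x : R) :
    \sum_(J : {set I}) \prod_i (if i \in J then x else 1 - x) = 1.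
  transitivity (\prod_(i : I) (x + (1 - x))); first by rewrite bigA_distr.
  by rewrite big1// => i _; rewrite subrKC.
rewrite /weight -(pair_bigA _ (fun (A : {set 'I_n}) (E : {set edge n}) =>
  (\prod_(v : 'I_n) (if v \in A then q else 1 - q)) *
  (\prod_(e : edge n) (if e \in E then p n else 1 - p n))))/=.
by under eq_bigr do rewrite -big_distrr/= tot mulr1; exact: tot.
Qed.

Definition Pr (T : finType) (mu : T -> R) (B : pred T) : R :=
  \sum_(w | B w) mu w.

(* X_n = o_p(a_n): X_n / a_n tends to 0 in probability; the n-th variable
   lives on its own sample space T n, with probability mass function mu n. *)
Definition is_op (T : nat -> finType) (mu X : forall n, T n -> R)
    (a : nat -> R) : Prop :=
  forall eps : R, 0 < eps ->
    (fun n => Pr (mu n) [pred w | eps < `|X n w / a n|]) @ \oo --> (0 : R).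

End Probability.

(* Main.v *)
Require Import Defs.
From HB Require Import structures.
From mathcomp Require Import all_boot all_order all_algebra.
From mathcomp Require Import all_classical all_reals all_analysis.
From mathcomp Require Import ring lra zify.
Import Order.TTheory GRing.Theory Num.Theory.
Import numFieldNormedType.Exports.

(** The proof compares, at each vertex [v], the degree [d] with the number [a] of
initially active neighbours.  The difference [d - 2 a] is a sum of [n - 1]
independent terms, equal to [-1], [1] or [0] with probabilities [p q],
[p (1 - q)] and [1 - p]; its mean is of order [n p (1 - 2 q)], while its
fluctuations are of order [sqrt (n p)].  The mean of [r^(d - 2 a)] with
[r = 2 q] makes this quantitative: a neighbour contributes the mean factor
[q / r + (1 - q) r = 1 - (1 - 2 q)^2 / 2 < 1], on whichever side of [1/2] the
parameter [q] lies ([mean_tilt]), so that this mean is at most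
[exp (- lambda n p / 2)], where [lambda = (1 - 2 q)^2 / 2] ([mean_tilt_np]).

If [q > 1/2], a vertex that stays inactive has [d - 2 a >= 0], so
[(2 q)^(d - 2 a)] is at least [1].  The expected number of inactive vertices is
thus at most [n exp (- lambda n p / 2) = o(n)] ([Pr_inactive_many]).

If [q < 1/2], the same mean shows that all but [o(n)] vertices satisfy
[d - 2 a >= theta n p] for some constant [theta > 0] ([Pr_unfavourable]).
Suppose that at least [k] vertices, [k ~ c n] for a small constant [c], become
active later on.  Activate vertices one at a time and stop after [k] of them:
each vertex of the resulting set [B] has at least half of its neighbours in the
union of [B] and the initial set ([exists_late_block]).  Hence each favourable
[v] in [B] has at least [theta n p / 2] neighbours inside [B].  At least half of
[B] is favourable, so [B] spans at least [k theta n p / 8] edges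
([late_block_edges]).  The expected number of edges inside [B] is at most
[p k^2 / 2], a quarter of this when [c <= theta / 16]; by a Chernoff bound, a
fixed [B] has so many edges with probability at most [exp (- const n^2 p)], and
this beats the [2^n] choices of [B] because [n p] tends to infinity
([Pr_dense_block]).  Finally the number of initially active vertices is at least
[q n / 4] with high probability ([Pr_few_initial]), so that [o(n)] late vertices
are negligible. *)

Set Implicit Arguments.
Unset Strict Implicit.
Unset Printing Implicit Defensive.

Local Open Scope classical_set_scope.
Local Open Scope ring_scope.

(** * Activation and edge counts in a fixed graph *)

Section Deterministic.
Variable n : nat.
Implicit Types (A B : {set 'I_n}) (E : {set edge n}) (u v : 'I_n).

(** The threshold compares rationals, half of an odd degree included; doubling
turns it into an inequality between natural numbers. *)
Lemma activableE E A v :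
  activable E A v =
    ((0 < active_deg E A v) && (deg E v <= 2 * active_deg E A v))%N.
Proof.
by rewrite /activable ge_max ler_pdivrMr// -natrM ler_nat ler1n andbC mulnC.
Qed.

Lemma active_degS E A B v : A \subset B ->
  (active_deg E A v <= active_deg E B v)%N.
Proof. by move=> AB; apply/subset_leq_card/finset.setIS. Qed.

Lemma activableS E A B v : A \subset B -> activable E A v -> activable E B v.
Proof.
move=> AB; rewrite !activableE => /andP[a0 da].
have ab := active_degS E v AB.
by apply/andP; split; lia.
Qed.

Lemma stepS E A B : A \subset B -> step E A \subset step E B.
Proof.
move=> AB; apply/fintype.subsetP => v; rewrite !inE => /orP[vA|va].
  by rewrite (fintype.subsetP AB).
by rewrite (activableS AB va) orbT.
Qed.

Lemma final_active_sub_closed E A B :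
  A \subset B -> step E B = B -> final_active E A \subset B.
Proof.
move=> AB hB; have iterB m : iter m (step E) A \subset B.
  by elim: m => //= m IH; rewrite -hB; exact: stepS.
exact: iterB.
Qed.

(** Synchronous rounds may jump over the cardinality [k], so vertices are
activated one at a time: as long as the block has fewer than [k] vertices, its
union with [A] does not contain the final set, hence is not stable, and some
vertex outside it can be activated.  Vertices that were activable remain so,
by monotonicity. *)
Lemma exists_late_block E A k : (k <= #|final_active E A :\: A|)%N ->
  exists2 B : {set 'I_n}, #|B| = k &
    forall v, v \in B -> activable E (A :|: B)%SET v.
Proof.
elim: k => [_|k IH kF].
  by exists finset.set0; rewrite ?cards0// => v; rewrite inE.
have [B cardB actB] := IH (ltnW kF).
have [v vAB vact] :
    exists2 v, v \notin (A :|: B)%SET & activable E (A :|: B)%SET v.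
  apply/exists_inP; apply: contraLR kF; rewrite negb_exists_in -leqNgt -cardB.
  move=> /forall_inP noact; apply/subset_leq_card.
  rewrite finset.subDset; apply: final_active_sub_closed.
    exact: finset.subsetUl.
  apply/setP => v; rewrite [in LHS]inE; case: (boolP (v \in _)) => //= vAB.
  by rewrite inE; exact/negbTE/noact.
exists (v |: B)%SET.
  by rewrite cardsU1 cardB; move: vAB; rewrite inE negb_or => /andP[_ ->].
have sub : (A :|: B)%SET \subset (A :|: (v |: B))%SET.
  by apply/finset.setUS/finset.subsetUr.
by move=> u /setU1P[->|uB]; apply: activableS sub _ => //; exact: actB.
Qed.

(** This is where edges being sets of exactly two elements matters: there are no
loops, and an edge at [v] has only one other end. *)
Lemma card_other_end (e : edge n) v :
  (#|[set u | val e == [set v; u]%SET]%SET| <= (v \in val e))%N.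
Proof.
case: (boolP (v \in val e)) => [ve|vNe].
  apply/card_le1_eqP => u u'; rewrite !inE => /eqP eu /eqP eu'.
  have vu : v != u.
    by apply: contraTneq (valP e) => vu; rewrite eu vu finset.setUid cards1.
  have : u \in [set v; u']%SET by rewrite -eu' eu set22.
  by rewrite !inE eq_sym (negbTE vu) /= => /eqP.
rewrite leqn0 cards_eq0; apply/eqP/setP => u; rewrite !inE.
by apply: contraNF vNe => /eqP ->; rewrite set21.
Qed.

(** Rewrites an iteration over neighbours, which are not independent pieces of
the sample space, as one over edges, which are.  The inner iteration has at most
one term, by [card_other_end]. *)
Lemma big_neighbours (S : Type) (idx : S) (op : Monoid.com_law idx)
    (F : 'I_n -> S) E v :
  \big[op/idx]_(u in neighbours E v) F u =
  \big[op/idx]_(e in E) \big[op/idx]_(u | val e == [set v; u]%SET) F u.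
Proof.
rewrite (exchange_big_dep predT)//= [LHS]big_mkcond/=.
apply: eq_bigr => u _; rewrite inE; case: ifPn => [/exists_inP[e eE ev]|nadj].
  rewrite (big_pred1 e)// => e' /=; apply/andP/eqP => [[_ e'v]|->//].
  by apply: val_inj; rewrite /= (eqP ev); exact/eqP.
rewrite big_pred0// => e; apply: contraNF nadj => /andP[eE ev].
by apply/exists_inP; exists e.
Qed.

Lemma handshake E B :
  (\sum_(v in B) #|neighbours E v :&: B| <=
   2 * #|[set e in E | val e \subset B]%SET|)%N.
Proof.
under eq_bigr => v vB.
  rewrite -sum1_card; under eq_bigl do rewrite inE.
  rewrite big_mkcondr/= big_neighbours.
  over.
rewrite exchange_big/= -sum1_card big_distrr/= [X in (_ <= X)%N]big_mkcond/=.
rewrite [X in (X <= _)%N]big_mkcond/=; apply: leq_sum => e _.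
rewrite inE; case: (e \in E) => //=; case: ifPn => [eB|eNB].
  rewrite muln1; apply: (@leq_trans #|val e|); last by rewrite (eqP (valP e)).
  rewrite -sum1_card [X in (_ <= X)%N]big_mkcond/=.
  rewrite big_mkcond/=; apply: leq_sum => v _; case: ifP => // vB.
  apply: leq_trans (card_other_end e v); rewrite -sum1_card.
  by under [X in (_ <= X)%N]eq_bigl do rewrite inE; apply: leq_sum => u _; case: ifP.
rewrite big1// => v vB; rewrite big1// => u /eqP eE; case: ifP => // uB.
move: eNB; rewrite eE => /negP[]; apply/fintype.subsetP => x.
by rewrite !inE => /orP[]/eqP->.
Qed.

Lemma card_edges_within B :
  #|[set e : edge n | val e \subset B]%SET| = 'C(#|B|, 2).
Proof.
rewrite -cards_draws -(card_imset _ val_inj); congr #|pred_of_set _|.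
apply/setP => S; apply/imsetP/idP => [[e]|]; rewrite !inE.
  by move=> eB ->; rewrite eB (valP e).
by move=> /andP[SB S2]; exists (exist _ S S2); rewrite ?inE.
Qed.

Lemma sub_final_active E A : A \subset final_active E A.
Proof.
have subiter m : A \subset iter m (step E) A.
  elim: m => //= m IH; apply: (fintype.subset_trans IH); exact: finset.subsetUl.
exact: subiter.
Qed.

Lemma activable_final E A v : activable E A v -> v \in final_active E A.
Proof.
move=> va; rewrite -step_final_active inE; apply/orP; right.
by rewrite inE; exact: activableS (sub_final_active E A) va.
Qed.

Lemma final_active0 E : final_active E finset.set0 = finset.set0.
Proof.
apply/eqP; rewrite -finset.subset0; apply: final_active_sub_closed => //.
apply/setP => v; rewrite !inE activableE.
by rewrite /active_deg finset.setI0 cards0.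
Qed.

(** A vertex of the block outside [bad] lacks a majority in [A] by [x], and being
activable with the help of [B] it must find [x / 2] neighbours in [B].  At least
[k / 2] vertices do, and each edge is counted twice. *)
Lemma late_block_edges (R : realDomainType) E A (bad : {set 'I_n}) k (x : R) :
  0 <= x ->
  (forall v, v \notin bad -> x <= (deg E v)%:R - 2 * (active_deg E A v)%:R) ->
  (k <= #|final_active E A :\: A|)%N -> (2 * #|bad| <= k)%N ->
  exists2 B : {set 'I_n}, #|B| = k &
    k%:R * x <= 8 * #|[set e in E | val e \subset B]%SET|%:R.
Proof.
move=> x0 good kF badk; have [B cardB actB] := exists_late_block kF.
exists B => //.
have hs : 2 * (\sum_(v in B) #|neighbours E v :&: B|)%:R <=
    4 * #|[set e in E | val e \subset B]%SET|%:R :> R.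
  by rewrite -!natrM ler_nat; have := handshake E B; lia.
suff: (#|B :\: bad|)%:R * x <= 2 * (\sum_(v in B) #|neighbours E v :&: B|)%:R.
  have : (k <= 2 * #|B :\: bad|)%N.
    have := cardsD B bad; have := subset_leq_card (finset.subsetIr B bad).
    by rewrite cardB; lia.
  rewrite -(ler_nat R) natrM => /(ler_wpM2r x0).
  move: hs; move: (\sum_(v in B) _)%N #|B :\: bad| #|[set e in E | _]%SET|.
  by move=> s m e; clear -x0; lra.
rewrite natr_sum mulr_natl -sumr_const big_distrr/=.
rewrite big_mkcond [leRHS]big_mkcond/=; apply: ler_sum => v _.
rewrite inE; case: (boolP (v \in B)) => [vB|_]; last by rewrite andbF.
case: (boolP (v \in bad)) => [_|/good vgood]/=; first by rewrite mulr_ge0.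
have /andP[_] : (0 < active_deg E (A :|: B) v)%N &&
    (deg E v <= 2 * active_deg E (A :|: B)%SET v)%N.
  by rewrite -activableE; exact: actB.
have : (active_deg E (A :|: B)%SET v <=
        active_deg E A v + #|neighbours E v :&: B|)%N.
  by rewrite /active_deg finset.setIUr cardsU leq_subr.
move: (active_deg E (A :|: B)%SET v) #|neighbours E v :&: B| vgood => ab b.
move: (deg E v) (active_deg E A v) => d a vgood abE dE.
have : (d <= 2 * (a + b))%N by lia.
by rewrite -(ler_nat R) natrM natrD; clear -vgood; lra.
Qed.

End Deterministic.

(** * Random subsets and union bounds *)

Section FiniteProbability.
Variable R : realType.

Definition mean (T : finType) (mu Z : T -> R) : R := \sum_w mu w * Z w.

Definition bernoulli_set (I : finType) (x : R) (J : {set I}) : R :=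
  \prod_i (if i \in J then x else 1 - x).

(** Independence in the form used throughout: the mean of a product with one
factor per element is the product of the means. *)
Lemma bernoulli_set_genfun (I : finType) (x : R) (g : I -> R) :
  mean (bernoulli_set x) (fun J => \prod_(i in J) g i) =
  \prod_i (1 - x + x * g i).
Proof.
under [RHS]eq_bigr do rewrite addrC.
rewrite bigA_distr; apply: eq_bigr => J _.
rewrite [X in _ * X]big_mkcond -big_split/=; apply: eq_bigr => i _.
by case: ifP; rewrite ?mulr1.
Qed.

Lemma mean_bernoulli_set1 (I : finType) (x : R) :
  mean (@bernoulli_set I x) (fun=> 1) = 1.
Proof.
transitivity (mean (@bernoulli_set I x) (fun J => \prod_(i in J) (1 : R))).
  by apply: eq_bigr => J _; rewrite big1.
by rewrite bernoulli_set_genfun big1// => i _; rewrite mulr1 subrK.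
Qed.

Lemma mean_weight (q : R) (p : nat -> R) n (Z : outcome n -> R) :
  mean (weight q p (n:=n)) Z =
  mean (bernoulli_set q)
    (fun A => mean (bernoulli_set (p n)) (fun E => Z (A, E))).
Proof.
rewrite /mean; under [RHS]eq_bigr do rewrite big_distrr/=.
by rewrite pair_bigA/=; apply: eq_bigr => -[A E] _; rewrite mulrA.
Qed.

Lemma Pr_ge0 (T : finType) (mu : T -> R) (B : pred T) :
  (forall w, 0 <= mu w) -> 0 <= Pr mu B.
Proof. by move=> mu0; apply: sumr_ge0. Qed.

Lemma Pr_markov (T : finType) (mu Z : T -> R) (B : pred T) (c : R) :
  (forall w, 0 <= mu w) -> (forall w, 0 <= Z w) -> 0 < c ->
  (forall w, B w -> c <= Z w) -> Pr mu B <= mean mu Z / c.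
Proof.
move=> mu0 Z0 c0 BZ; rewrite ler_pdivlMr// /Pr big_distrl/= big_mkcond/=.
apply: ler_sum => w _; case: ifP => [wB|_]; last by rewrite mulr_ge0.
by rewrite ler_wpM2l// BZ.
Qed.

Lemma Pr_subU (T : finType) (mu : T -> R) (B C D : pred T) :
  (forall w, 0 <= mu w) -> (forall w, B w -> C w || D w) ->
  Pr mu B <= Pr mu C + Pr mu D.
Proof.
move=> mu0 BCD; rewrite /Pr 3!(big_mkcond _ mu)/= -big_split/=.
apply: ler_sum => w _; have := BCD w.
case: (B w) => [/(_ isT)|_]; last by rewrite addr_ge0//; case: ifP.
by case: (C w) => /= [_|->]; rewrite ?add0r// lerDl; case: ifP.
Qed.

Lemma Pr_exists (I T : finType) (mu : T -> R) (P : pred I) (B : I -> pred T) :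
  (forall w, 0 <= mu w) ->
  Pr mu [pred w | [exists (i | P i), B i w]] <= \sum_(i | P i) Pr mu (B i).
Proof.
move=> mu0; rewrite /Pr; under [leRHS]eq_bigr do rewrite big_mkcond/=.
rewrite exchange_big/= big_mkcond/=; apply: ler_sum => w _.
case: ifP => [/exists_inP[i iP iw]|_].
  rewrite (bigD1 i)//= iw lerDl; apply: sumr_ge0 => j _; by case: ifP.
by apply: sumr_ge0 => j _; case: ifP.
Qed.

(** Markov's inequality for the number of events that occur. *)
Lemma Pr_many (I T : finType) (mu : T -> R) (B : I -> pred T) (b c : R) :
  (forall w, 0 <= mu w) -> (forall i, Pr mu (B i) <= b) -> 0 < c ->
  Pr mu [pred w | c <= #|[set i | B i w]%SET|%:R] <= #|I|%:R * b / c.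
Proof.
move=> mu0 Bb c0.
pose N w : R := #|[set i | B i w]%SET|%:R.
apply: (le_trans (@Pr_markov _ mu N _ c _ _ _ _)) => //.
rewrite ler_pM2r ?invr_gt0//.
have -> : mean mu N = \sum_i Pr mu (B i).
  rewrite /Pr; under [RHS]eq_bigr do rewrite big_mkcond/=.
  rewrite exchange_big/=; apply: eq_bigr => w _.
  rewrite /N -sum1_card natr_sum big_distrr big_mkcond/=; apply: eq_bigr => i _.
  by rewrite inE mulr1.
rewrite mulr_natl -sumr_const; exact: ler_sum.
Qed.

End FiniteProbability.

(** * Exponential moments *)

Section Moments.
Variables (R : realType) (q : R) (p : nat -> R) (n : nat).
Local Notation mu := (weight q p (n:=n)).

(** This is [r^(d - 2 a)] for [r > 0], by [tiltE], written as a product so that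
independence applies. *)
Definition tilt (r : R) (v : 'I_n) (w : outcome n) : R :=
  \prod_(u in neighbours w.2 v) (if u \in w.1 then r^-1 else r).

Lemma tiltE r v w : 0 < r ->
  tilt r v w = expR (ln r * ((deg w.2 v)%:R - 2 * (active_deg w.2 w.1 v)%:R)).
Proof.
move=> r0; pose h u : R := ln r * (1 - 2 * (u \in w.1)%:R).
transitivity (\prod_(u in neighbours w.2 v) expR (h u)).
  apply: eq_bigr => u _; rewrite /h; case: ifP => _.
    rewrite mulr1 (_ : 1 - 2 = - 1 :> R); last by ring.
    by rewrite mulrN1 expRN lnK.
  by rewrite mulr0 subr0 mulr1 lnK.
rewrite -expR_sum -big_distrr/= big_split/= sumr_const sumrN -big_distrr/=.
rewrite /active_deg -sum1_card natr_sum; congr (expR (_ * (_ - 2 * _))).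
rewrite [in RHS](eq_bigl (fun u => (u \in neighbours w.2 v) && (u \in w.1))).
  by rewrite [RHS]big_mkcondr/=; apply: eq_bigr => u _; case: (u \in _).
by move=> u; rewrite !inE.
Qed.

(** Given the initial set, each of the [n - 1] edges at [v] contributes one
factor; these factors depend on the states of distinct vertices, so averaging
over the initial set again factorizes. *)
Lemma mean_tilt r v :
  mean mu (tilt r v) = (1 - p n + p n * (q * r^-1 + (1 - q) * r)) ^+ n.-1.
Proof.
rewrite mean_weight.
transitivity (mean (bernoulli_set q) (fun A =>
   \prod_(u | u != v) (1 - p n + p n * (if u \in A then r^-1 else r)))).
  apply: eq_bigr => A _; congr (_ * _).
  transitivity (mean (bernoulli_set (p n)) (fun E : {set edge n} => \prod_(e in E)
      \prod_(u | val e == [set v; u]%SET) (if u \in A then r^-1 else r))).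
    by apply: eq_bigr => E _; rewrite /tilt/= big_neighbours.
  rewrite bernoulli_set_genfun.
  (* In the complete graph, the neighbours of v are the vertices other than v. *)
  transitivity (\prod_(u in neighbours [set: edge n]%SET v)
      (1 - p n + p n * (if u \in A then r^-1 else r))).
    (* The product over the ends of e other than v has at most one factor, so
       the affine map 1 - p + p * x, which fixes 1, commutes with it. *)
    rewrite big_neighbours [RHS]big_mkcond; apply: eq_bigr => e _.
    rewrite finset.in_setT.
    have := card_other_end e v.
    set S := [set u | _]%SET => S1.
    have {S1} : (#|S| <= 1)%N by apply: leq_trans S1 _; case: (v \in _).
    have inS u : (val e == [set v; u]%SET) = (u \in S) by rewrite inE.
    rewrite !(eq_bigl _ _ inS).
    rewrite leq_eqVlt ltnS leqn0 cards_eq0 => /orP[/cards1P[u ->]|/eqP->].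
      by rewrite !big_set1.
    by rewrite !big_set0 mulr1 subrK.
  apply: eq_bigl => u; rewrite inE; apply/exists_inP/idP => [[e _ /eqP ev]|uv].
    by apply: contraTneq (valP e) => vu; rewrite ev vu finset.setUid cards1.
  have uv2 : #|[set v; u]%SET| == 2%N by rewrite cards2 (eq_sym v u) uv.
  by exists (exist (fun S : {set _} => #|S| == 2%N) _ uv2); rewrite ?inE.
rewrite /mean.
transitivity (\sum_(A : {set 'I_n}) \prod_u (if u \in A
   then q * (if u != v then 1 - p n + p n * r^-1 else 1)
   else (1 - q) * (if u != v then 1 - p n + p n * r else 1))).
  apply: eq_bigr => A _; rewrite [X in _ * X]big_mkcond -big_split/=.
  by apply: eq_bigr => u _; case: (u \in A).
rewrite -bigA_distr (bigD1 v)//= eqxx !mulr1 subrKC mul1r.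
have cardv : #|predC1 v| = n.-1.
  by have := cardC1 v; rewrite card_ord.
rewrite -cardv -prodr_const; apply: eq_bigr => u uv; rewrite uv; ring.
Qed.

Hypotheses (hp : 0 <= p n <= 1) (hq : 0 < q < 1).

Lemma mu_ge0 w : 0 <= mu w.
Proof. by apply: weight_ge0 => //; move: hq => /andP[/ltW-> /ltW->]. Qed.

(** The choice [r = 2 q] turns [q / r + (1 - q) r] into
[1 - (1 - 2 q)^2 / 2], for [q] on either side of [1/2]; then [1 + x <= exp x]. *)
Lemma mean_tilt_le v :
  mean mu (tilt (2 * q) v) <= expR (- ((1 - 2 * q) ^+ 2 / 2 * p n * n.-1%:R)).
Proof.
rewrite mean_tilt; set b := (X in X ^+ _).
have -> : b = 1 - (1 - 2 * q) ^+ 2 / 2 * p n.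
  rewrite /b; field.
  by move: hq => /andP[q0 _]; rewrite lt0r_neq0.
rewrite [X in expR (- X)]mulrC -[X in expR X]mulrN expRM_natl.
move: hp hq => /andP[p0 p1] /andP[q0 q1].
apply: lerXn2r; rewrite ?nnegrE ?expR_ge0//; last exact: expR_ge1Dx.
rewrite subr_ge0 mulr_ile1//; last by nra.
by rewrite divr_ge0// sqr_ge0.
Qed.

(** The exponent [1/2] is chosen because [exp (1/2) <= 2], so that an edge
contributes a factor at most [1 + p <= exp p]. *)
Lemma mean_edges_within (B : {set 'I_n}) :
  mean mu (fun w => expR (2^-1 * #|[set e in w.2 | val e \subset B]%SET|%:R)) <=
  expR (p n * 'C(#|B|, 2)%:R).
Proof.
pose g (e : edge n) : R := if val e \subset B then expR 2^-1 else 1.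
have q1 := @mean_bernoulli_set1 R 'I_n q.
have -> : mean mu (fun w =>
    expR (2^-1 * #|[set e in w.2 | val e \subset B]%SET|%:R)) =
    \prod_e (1 - p n + p n * g e).
  rewrite mean_weight -bernoulli_set_genfun -[RHS]mul1r -[X in _ = X * _]q1.
  rewrite /mean [RHS]big_distrl/=; apply: eq_bigr => A _; rewrite mulr1; congr (_ * _).
  apply: eq_bigr => E _; congr (_ * _).
  rewrite mulrC expRM_natl -prodr_const big_mkcond [RHS]big_mkcond/=.
  by apply: eq_bigr => e _; rewrite inE /g; case: (e \in E).
rewrite -card_edges_within mulrC expRM_natl -prodr_const.
rewrite [leRHS]big_mkcond/=; apply: ler_prod => e _; rewrite inE /g.
move: hp => /andP[p0 p1].
have e2 : expR 2^-1 <= 2 :> R.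
  rewrite -[2^-1]opprK expRN -[leRHS]invrK lef_pV2 ?posrE ?expR_gt0//.
  by apply: le_trans (expR_ge1Dx _); lra.
have := expR_gt0 (2^-1 : R); have := @expR_ge1Dx R (p n).
by case: ifP => _ *; apply/andP; split; nra.
Qed.

Lemma mean_initial :
  mean mu (fun w => expR (- (A0 w)%:R)) <= expR (- (q / 2 * n%:R)).
Proof.
have p1 := @mean_bernoulli_set1 R (edge n) (p n).
have -> : mean mu (fun w => expR (- (A0 w)%:R)) =
    \prod_(i < n) (1 - q + q * expR (-1)).
  rewrite mean_weight -bernoulli_set_genfun; apply: eq_bigr => A _; congr (_ * _).
  rewrite -[RHS]mul1r -[X in _ = X * _]p1 [RHS]big_distrl/=; apply: eq_bigr => E _.
  by rewrite mulr1 /A0/= prodr_const -expRM_natl mulrN1.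
rewrite prodr_const card_ord -mulNr [X in _ <= expR X]mulrC expRM_natl.
have e2 : expR (-1) <= 2^-1 :> R.
  by rewrite expRN lef_pV2 ?posrE ?expR_gt0//; apply: le_trans (expR_ge1Dx _); lra.
have e0 := expR_gt0 (-1 : R).
move: hq => /andP[q0 q1].
apply: lerXn2r; rewrite ?nnegrE ?expR_ge0//; first by nra.
by apply: le_trans (expR_ge1Dx _); nra.
Qed.

End Moments.

(** * Tail bounds *)

Section Tails.
Variables (R : realType) (q : R) (p : nat -> R) (n : nat).
Hypotheses (hp : 0 <= p n <= 1) (hq : 0 < q < 1) (n2 : (2 <= n)%N).
Local Notation mu := (weight q p (n:=n)).
Local Notation lam := ((1 - 2 * q) ^+ 2 / 2).
Local Notation np := (n%:R * p n).

Lemma mean_tilt_np v : mean mu (tilt (2 * q) v) <= expR (- (lam / 2 * np)).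
Proof.
apply: le_trans (mean_tilt_le hp hq v) _.
rewrite ler_expR lerN2.
have : n%:R <= 2 * n.-1%:R :> R by rewrite -natrM ler_nat; lia.
have : 0 <= lam by rewrite divr_ge0// sqr_ge0.
by move: hp => /andP[p0 _]; move: lam => l /mulr_ge0/(_ p0) lp0 n_le; nra.
Qed.

Lemma tilt_ge0 v (w : outcome n) : 0 <= tilt (2 * q) v w.
Proof. by rewrite tiltE ?expR_ge0// mulr_gt0//; case/andP: hq. Qed.

(** An inactive vertex has [2 a <= d], both when it has too few active neighbours
and when it has none at all; as [2 q > 1], its tilt is then at least [1]. *)
Lemma Pr_inactive_many (c : R) : 1 / 2 < q -> 0 < c ->
  Pr mu [pred w | c <= #|[set v | v \notin final_active w.2 w.1]%SET|%:R] <=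
  n%:R * expR (- (lam / 2 * np)) / c.
Proof.
move=> qhalf c0; rewrite -[X in _ <= X%:R * _ / _]card_ord.
apply: (@Pr_many _ _ _ _ (fun v w => v \notin final_active w.2 w.1)) => //.
  exact: mu_ge0.
move=> v; apply: le_trans (mean_tilt_np v).
rewrite -[leRHS]divr1; apply: Pr_markov => //; first exact: mu_ge0.
- exact: tilt_ge0.
- move=> w /(contra (@activable_final _ _ _ _)).
  rewrite activableE negb_and -leqNgt -ltnNge => ina.
  have {ina} : (2 * active_deg w.2 w.1 v <= deg w.2 v)%N.
    by move: ina => /orP[]; lia.
  rewrite -(ler_nat R) natrM => da.
  rewrite tiltE; last by lra.
  rewrite -[leLHS]expR0 ler_expR; apply: mulr_ge0; last by rewrite subr_ge0.
  by apply/ltW/ln_gt0; lra.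
Qed.

(** As [2 q < 1], a small [d - 2 a] makes the tilt at least
[(2 q)^(theta n p)]; the bound on [theta] ensures that dividing by this costs
at most half of the exponent in [mean_tilt_np]. *)
Lemma Pr_unfavourable (theta : R) v : q < 1 / 2 -> 0 < theta ->
  theta * - ln (2 * q) <= lam / 4 ->
  Pr mu [pred w : outcome n |
    (deg w.2 v)%:R - 2 * (active_deg w.2 w.1 v)%:R < theta * np] <=
  expR (- (lam / 4 * np)).
Proof.
move=> qhalf th0 thl; have q0 : 0 < q by case/andP: hq.
have np0 : 0 <= np by rewrite mulr_ge0//; case/andP: hp.
have ln0 : ln (2 * q) < 0 by rewrite ln_lt0//; lra.
apply: (@le_trans _ _ (mean mu (tilt (2 * q) v) / expR (ln (2 * q) * (theta * np)))).
  apply: Pr_markov; [exact: mu_ge0|exact: tilt_ge0|exact: expR_gt0|].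
  move=> w /= h; rewrite tiltE; last by lra.
  rewrite ler_expR; move: h; set d := (_ - _) => h.
  by rewrite ler_wnM2l// ltW.
rewrite ler_pdivrMr ?expR_gt0// -expRD; apply: le_trans (mean_tilt_np v) _.
rewrite ler_expR; move: thl np0; move: lam np (ln _) => l x y; nra.
Qed.

(** Chernoff bound for each [B], and a union bound over at most
[2^n <= exp n] sets. *)
Lemma Pr_dense_block k (x : R) : 0 <= x ->
  Pr mu [pred w : outcome n | [exists (B : {set 'I_n} | #|B| == k),
     k%:R * x <= 8 * #|[set e in w.2 | val e \subset B]%SET|%:R]] <=
  expR (n%:R + p n * (k%:R ^+ 2 / 2) - k%:R * x / 16).
Proof.
move=> x0; have p0 : 0 <= p n by case/andP: hp.
pose dense (B : {set 'I_n}) (w : outcome n) :=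
  k%:R * x <= 8 * #|[set e in w.2 | val e \subset B]%SET|%:R.
apply: (@le_trans _ _ (\sum_(B : {set 'I_n} | #|B| == k) Pr mu (dense B))).
  exact: (@Pr_exists R _ _ _ (fun B : {set 'I_n} => #|B| == k) dense (mu_ge0 hp hq)).
pose b : R := expR (p n * (k%:R ^+ 2 / 2) - k%:R * x / 16).
apply: (@le_trans _ _ (\sum_(B : {set 'I_n} | #|B| == k) b)).
  apply: ler_sum => B /eqP cardB.
  apply: (@le_trans _ _ (mean mu (fun w => expR (2^-1 *
      #|[set e in w.2 | val e \subset B]%SET|%:R)) / expR (k%:R * x / 16))).
    apply: Pr_markov; [exact: mu_ge0|by move=> w; exact: expR_ge0|exact: expR_gt0|].
    by move=> w; rewrite /dense ler_expR; lra.
  rewrite ler_pdivrMr ?expR_gt0// /b -expRD subrK.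
  apply: le_trans (mean_edges_within q hp B) _.
  rewrite ler_expR ler_wpM2l// cardB.
  have : (2 * 'C(k, 2) <= k ^ 2)%N.
    by rewrite bin2; nia.
  by rewrite -(ler_nat R) natrM natrX; lra.
rewrite sumr_const -[leLHS]mulr_natl -addrA expRD -/b ler_wpM2r ?expR_ge0//.
apply: (@le_trans _ _ (2 ^+ n)).
  rewrite -natrX ler_nat; apply: leq_trans (max_card _) _.
  by rewrite -finset.cardsT -powersetT card_powerset finset.cardsT card_ord.
rewrite -[n%:R]mulr1 expRM_natl; apply: lerXn2r; rewrite ?nnegrE ?expR_ge0//.
by apply: le_trans (expR_ge1Dx _); lra.
Qed.

(** Many late activations force either at least [k / 2] unfavourable vertices or
an abnormally dense block of [k] vertices. *)
Lemma Pr_late_many (theta : R) k : q < 1 / 2 -> 0 < theta ->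
  theta * - ln (2 * q) <= lam / 4 -> (0 < k)%N ->
  Pr mu [pred w | (k <= #|final_active w.2 w.1 :\: w.1|)%N] <=
  n%:R * expR (- (lam / 4 * np)) / (k%:R / 2) +
  expR (n%:R + p n * (k%:R ^+ 2 / 2) - k%:R * (theta * np) / 16).
Proof.
move=> qhalf th0 thl k0.
have np0 : 0 <= np by rewrite mulr_ge0//; case/andP: hp.
have x0 : 0 <= theta * np by rewrite mulr_ge0// ltW.
pose bad v (w : outcome n) :=
  (deg w.2 v)%:R - 2 * (active_deg w.2 w.1 v)%:R < theta * np.
pose dense : pred (outcome n) := fun w => [exists (B : {set 'I_n} | #|B| == k),
  k%:R * (theta * np) <= 8 * #|[set e in w.2 | val e \subset B]%SET|%:R].
pose many_bad : pred (outcome n) :=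
  fun w => k%:R / 2 <= #|[set v | bad v w]%SET|%:R :> R.
apply: (@le_trans _ _ (Pr mu many_bad + Pr mu dense)); last first.
  apply: lerD; last exact: Pr_dense_block.
  rewrite -[X in _ <= X%:R * _ / _]card_ord.
  apply: (@Pr_many _ _ _ _ bad); first exact: mu_ge0.
    by move=> v; exact: Pr_unfavourable.
  by rewrite divr_gt0// ltr0n.
apply: Pr_subU; first exact: mu_ge0.
move=> w /= late; rewrite /many_bad /dense /=; case: leP => //= fewbad.
have [|//||B cardB edgesB] := @late_block_edges _ R w.2 w.1
   [set v | bad v w]%SET k (theta * np) x0.
- by move=> v; rewrite inE /bad -leNgt.
- by rewrite -(ler_nat R) natrM; lra.
by apply/exists_inP; exists B; rewrite ?cardB.
Qed.

Lemma Pr_few_initial :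
  Pr mu [pred w : outcome n | (A0 w)%:R <= q / 4 * n%:R] <= expR (- (q / 4 * n%:R)).
Proof.
apply: (@le_trans _ _ (mean mu (fun w : outcome n => expR (- (A0 w)%:R)) /
    expR (- (q / 4 * n%:R)))).
  apply: Pr_markov; [exact: mu_ge0|by move=> w; exact: expR_ge0|exact: expR_gt0|].
  by move=> w /= h; rewrite ler_expR lerN2.
rewrite ler_pdivrMr ?expR_gt0// -expRD; apply: le_trans (mean_initial p n hq) _.
by rewrite ler_expR; lra.
Qed.

End Tails.

(** * Passage to the limit *)

Section Asymptotics.
Variables (R : realType) (p : nat -> R).
Hypothesis hnp : (fun n : nat => n%:R * p n) @ \oo --> +oo.

Lemma cvg_expR_np (K c : R) : 0 < c ->
  (fun n => K * expR (- (c * (n%:R * p n)))) @ \oo --> (0 : R).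
Proof.
move=> c0; rewrite -[0 in X in _ --> X](mulr0 K); apply: cvgMr.
have h : (fun n => n%:R * p n * c) @ \oo --> +oo.
  exact: (cvg_comp _ _ hnp (gt0_cvgMly c0 cvg_id)).
have := cvg_comp _ _ h (@cvgr_expR R); apply: cvg_trans.
by apply: near_eq_cvg; apply: nearW => n /=; rewrite [c * _]mulrC.
Qed.

(** Convergence allows bounds to be asked for only from [n = 2] on, where [p n] is
a probability and [n - 1 >= n / 2], and only when [n p n] is large. *)
Lemma is_op_near (q : R) (hq : 0 < q < 1)
    (hp : forall n, (0 < n)%N -> 0 <= p n <= 1)
    (X : forall n, outcome n -> R) (a : nat -> R) :
  (forall eps : R, 0 < eps -> exists M : R, exists2 h : nat -> R,
     h @ \oo --> (0 : R) &
     forall n, (2 <= n)%N -> M <= n%:R * p n ->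
       Pr (weight q p (n:=n)) [pred w | eps < `|X n w / a n|] <= h n) ->
  is_op (weight q p) X a.
Proof.
move=> bound eps /bound[M [h h0 hX]].
apply: (squeeze_cvgr _ (cvg_cst 0) h0).
near=> n; have n2 : (2 <= n)%N by near: n; exact: nbhs_infty_ge.
apply/andP; split.
  by apply: Pr_ge0; apply: mu_ge0 => //; apply: hp; exact: ltnW.
apply: hX => //; near: n; move/cvgryPge: hnp; exact.
Unshelve. all: by end_near. Qed.

End Asymptotics.

Unset Implicit Arguments.

Theorem corollary3p6 (R : realType) (p : nat -> R) (q : R)
    (hp : forall n : nat, (0 < n)%N -> 0 <= p n <= 1)
    (hnp : (fun n : nat => n%:R * p n) @ \oo --> +oo)
    (hq : 0 < q < 1) :
  (q < 1 / 2 ->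
    exists X : forall n : nat, outcome n -> R,
      is_op (weight q p) X (fun=> 1) /\
      (forall (n : nat) (w : outcome n),
        (Astar w)%:R = (A0 w)%:R * (1 + X n w))) /\
  (1 / 2 < q ->
    exists Y : forall n : nat, outcome n -> R,
      is_op (weight q p) Y (fun n => n%:R) /\
      (forall (n : nat) (w : outcome n),
        (Astar w)%:R = n%:R - Y n w)).
Proof.
have /andP[q0 q1] := hq.
pose lam : R := (1 - 2 * q) ^+ 2 / 2.
split=> qhalf.
- have ln0 : ln (2 * q) < 0 by rewrite ln_lt0//; lra.
  have lam0 : 0 < lam by rewrite divr_gt0// exprn_even_gt0//=; lra.
  pose theta := lam / 4 / - ln (2 * q).
  have th0 : 0 < theta by apply: divr_gt0; [exact: divr_gt0|rewrite oppr_gt0].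
  have thl : theta * - ln (2 * q) <= lam / 4 by rewrite divfK// oppr_eq0 lt_eqF.
  exists (fun n w => (Astar w)%:R / (A0 w)%:R - 1); split; last first.
    move=> n [A E]; rewrite addrC subrK /Astar /A0/=.
    have [->|A0] := eqVneq A finset.set0; first by rewrite final_active0 cards0 mul0r.
    by rewrite mulrC divfK// pnatr_eq0 cards_eq0.
  apply: (is_op_near hnp hq hp) => eps eps0.
  (* The first constraint makes c * n late vertices negligible compared with
     eps times the initial set; the second makes the expected number of edges
     in a set of c * n vertices too small for a late block. *)
  pose c := Num.min (eps * (q / 4)) (theta / 16).
  have c0 : 0 < c by rewrite lt_min; apply/andP; split; nra.
  have [ceps cth] : c <= eps * (q / 4) /\ c <= theta / 16.
    by split; rewrite /c ge_min lexx ?orbT.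
  (* As n p <= n, the first bound gives c * n >= 2, so that truncating c * n
     loses at most half of it.  The second makes the exponent
     n * (1 - c * theta * n p / 64) of the dense block bound at most
     1 - c * theta * n p / 64. *)
  exists (Num.max (2 / c) (64 / (c * theta))).
  exists (fun n => expR (- (q / 4 * (n%:R * p n))) +
     (4 / c * expR (- (lam / 4 * (n%:R * p n))) +
      expR 1 * expR (- (c * theta / 64 * (n%:R * p n))))).
    rewrite -[0 in X in _ --> X](addr0 0); apply: cvgD.
      have := cvg_expR_np hnp 1 (_ : 0 < q / 4).
      by under eq_fun do rewrite mul1r; apply; lra.
    rewrite -[0 in X in _ --> X](addr0 0).
    apply: cvgD; apply: cvg_expR_np => //; first exact: divr_gt0.
    by rewrite divr_gt0// mulr_gt0.
  move=> n n2; rewrite ge_max => /andP[].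
  rewrite ler_pdivrMr// ler_pdivrMr ?(mulr_gt0 c0 th0)// => cnp thnp.
  have hpn : 0 <= p n <= 1 by apply: hp; exact: ltnW.
  have /andP[p0 p1] := hpn.
  have n_ge1 : 1 <= n%:R :> R by rewrite ler1n ltnW.
  have npn : n%:R * p n <= n%:R by rewrite ler_piMr.
  have cn : 2 <= c * n%:R.
    by rewrite mulrC; apply: le_trans cnp _; rewrite ler_wpM2r// ltW.
  pose k := Num.trunc (c * n%:R).
  have /andP[kcn cnk] : k%:R <= c * n%:R < k.+1%:R by apply: truncn_itv; lra.
  have k0 : (0 < k)%N by rewrite truncn_gt0; lra.
  have kcn2 : c * n%:R / 2 <= k%:R by move: cnk; rewrite -natr1; lra.
  apply: (le_trans (@Pr_subU _ _ _ _ [pred w : outcome n | (A0 w)%:R <= q / 4 * n%:R]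
     [pred w | (k <= #|final_active w.2 w.1 :\: w.1|)%N] (mu_ge0 hpn hq) _)).
    move=> w /= Xeps; case: leP => //= manyA0; move: Xeps; rewrite divr1 => Xeps.
    have A00 : 0 < (A0 w)%:R :> R by apply: le_lt_trans manyA0; nra.
    have lateE : (Astar w)%:R = (A0 w)%:R + #|final_active w.2 w.1 :\: w.1|%:R :> R.
      rewrite -natrD; congr _%:R; rewrite /Astar /A0.
      have := cardsID w.1 (final_active w.2 w.1).
      by rewrite (finset.setIidPr (sub_final_active _ _)) => <-.
    move: Xeps; rewrite lateE mulrDl divff ?gt_eqF// addrC addKr.
    rewrite ger0_norm ?divr_ge0// ltr_pdivlMr// => late.
    rewrite -(ler_nat R); nra.
  apply: lerD.
    apply: le_trans (Pr_few_initial hpn hq) _; rewrite ler_expR; nra.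
  apply: le_trans (Pr_late_many hpn hq n2 qhalf th0 thl k0) _.
  apply: lerD.
    rewrite -/lam mulrAC ler_wpM2r ?expR_ge0//.
    rewrite ler_pdivrMr; last by rewrite divr_gt0// ltr0n.
    have -> : 4 / c * (k%:R / 2) = 2 * k%:R / c by field; rewrite gt_eqF.
    rewrite ler_pdivlMr//; lra.
  rewrite -expRD ler_expR.
  have k0R : 0 <= k%:R :> R by [].
  have np0 : 0 <= n%:R * p n by rewrite mulr_ge0.
  have kth : k%:R <= theta / 16 * n%:R by apply: le_trans kcn _; rewrite ler_wpM2r.
  have edges := ler_wpM2l (mulr_ge0 p0 k0R) kth.
  have gain := ler_wpM2r (mulr_ge0 np0 (ltW th0)) kcn2.
  have large : 0 <= (n%:R - 1) * (n%:R * p n * (c * theta) - 64).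
    by rewrite mulr_ge0 ?subr_ge0.
  move: (k%:R : R) (n%:R : R) (p n) edges gain large => x y z; clear; nra.
- have lam0 : 0 < lam by rewrite divr_gt0// exprn_even_gt0//=; lra.
  exists (fun n w => n%:R - (Astar w)%:R); split; last by move=> n w; rewrite subKr.
  apply: (is_op_near hnp hq hp) => eps eps0; exists 0.
  exists (fun n => eps^-1 * expR (- (lam / 2 * (n%:R * p n)))).
    by apply: cvg_expR_np => //; rewrite divr_gt0.
  move=> n n2 _.
  have hpn : 0 <= p n <= 1 by apply: hp; exact: ltnW.
  have n0 : 0 < n%:R :> R by rewrite ltr0n ltnW.
  have epsn : 0 < eps * n%:R by rewrite mulr_gt0.
  have -> : eps^-1 * expR (- (lam / 2 * (n%:R * p n))) =
      n%:R * expR (- (lam / 2 * (n%:R * p n))) / (eps * n%:R).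
    by field; rewrite !gt_eqF.
  apply: le_trans _ (Pr_inactive_many hpn hq n2 qhalf epsn).
  rewrite /Pr big_mkcond [leRHS]big_mkcond/=; apply: ler_sum => w _.
  have -> : n%:R - (Astar w)%:R = #|[set v | v \notin final_active w.2 w.1]%SET|%:R :> R.
    have := cardsC (final_active w.2 w.1); rewrite card_ord => {1}<-.
    by rewrite natrD addrC addKr.
  rewrite ger0_norm ?divr_ge0// ltr_pdivlMr//.
  case: ifP => [/ltW->//|_]; case: ifP => // _; exact: mu_ge0.
Qed.
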